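(* Let $L$ and $T$ be positive integers, let $p_1<p_2<\cdots<p_L$ be prime numbers, let $q_0$ be a prime power with $q_0\ge N_L$, and set $q=q_0^{p_1p_2\cdots p_L}$, where $N_i=p_i+2L+2T-2$ for every $i\in[L]$. Let $A\in\mathbb{F}_q^{a\times b}$ and $B\in\mathbb{F}_q^{b\times c}$ with $L\mid b$. Then the FTP code with partitioning parameter $L$ and security parameter $T$ (described in the context) uses $N_L$ servers, is $T$-secure, allows the user to recover $AB$ from the servers' responses, and has total communication rate $$\mathcal{R}=\left(\frac{N_L b}{L}\left(\frac{1}{a}+\frac{1}{c}\right)+\sum_{i=1}^{L}\frac{N_i}{p_i}\right)^{-1}.$$
   Context: Notation: $[M]=\{1,\dots,M\}$, $[M:N]=\{M,\dots,N\}$. For a finite field extension $\mathbb{E}/\mathbb{F}$ of degree $s$, $\operatorname{tr}_{\mathbb{E}/\mathbb{F}}(x)=x+x^{|\mathbb{F}|}+\cdots+x^{|\mathbb{F}|^{s-1}}$; traces are applied entrywise to matrices. FTP code (field trace polynomial code) with parameters $L,T,p_1<\dots<p_L,q_0$ as in the claim: Partition $A=[A_1\ \cdots\ A_L]$ with $A_i\in\mathbb{F}_q^{a\times b/L}$ and $B^{\intercal}=[B_1^{\intercal}\ \cdots\ B_L^{\intercal}]$ with $B_i\in\mathbb{F}_q^{b/L\times c}$, so $AB=\sum_i A_iB_i$. Let $n=N_L+L$. For $i\in[L]$ pick $\alpha_i\in\mathbb{F}_q$ with $[\mathbb{F}_{q_0}(\alpha_i):\mathbb{F}_{q_0}]=p_i$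 (so $\mathbb{F}_q=\mathbb{F}_{q_0}(\alpha_1,\dots,\alpha_L)$), and let $F_i=\mathbb{F}_{q_0}(\alpha_j: j\in[L], j\ne i)$, so $[\mathbb{F}_q:F_i]=p_i$. Pick distinct $\alpha_{L+1},\dots,\alpha_n\in\mathbb{F}_{q_0}$. Choose $R_1,\dots,R_T\in\mathbb{F}_q^{a\times b/L}$ and $S_1,\dots,S_T\in\mathbb{F}_q^{b/L\times c}$ independently and uniformly at random, independent of $(A,B)$. Let $f,g$ be the polynomials (with matrix coefficients over $\mathbb{F}_q$) of degree at most $L+T-1$ with $f(\alpha_i)=A_i$, $g(\alpha_i)=B_i$ for $i\in[L]$ and $f(\alpha_{L+j})=R_j$, $g(\alpha_{L+j})=S_j$ for $j\in[T]$; let $h=fg$. Upload: server $j\in[N_L]$ receives $f(\alpha_{L+j})$ and $g(\alpha_{L+j})$ and computes $h(\alpha_{L+j})=f(\alpha_{L+j})g(\alpha_{L+j})$. Let $v_j=\prod_{i\in[n],i\ne j}(\alpha_j-\alpha_i)^{-1}$, $U_i=[L+1:L+N_i]$, and $k_i(x)=\prod_{j\in[n]\setminus(U_i\cup\{i\})}(x-\alpha_j)$. Download: for each $i\in[L]$ and each server $j\in[N_i]$, server $j$ sends the $a\times c$ matrix over $F_i$ given by $\operatorname{tr}_{\mathbb{F}_q/F_i}(v_{L+j}k_i(\alpha_{L+j})h(\alpha_{L+j}))$. $T$-secure: for every set of $T$ servers, the mutual information between $(A,B)$ and the data uploaded to those servers is zero. Total communication rate: (number of $\mathbb{F}_{q_0}$-symbols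 of $AB$)/(number of $\mathbb{F}_{q_0}$-symbols uploaded plus downloaded), where an element of $\mathbb{F}_q$ counts as $p_1\cdots p_L$ symbols and an element of $F_i$ as $\prod_{j\ne i}p_j$ symbols. *)

(* Defs.v *)
From HB Require Import structures.
From mathcomp Require Import all_boot all_order all_algebra.
From mathcomp Require Import reals exp.

Set Implicit Arguments.
Unset Strict Implicit.
Unset Printing Implicit Defensive.

Import Order.TTheory GRing.Theory Num.Theory.
Local Open Scope ring_scope.

(* All indices are 1-based as in the paper: i in [1, L], servers j in [1, N_L],
   evaluation points alpha 1, ..., alpha n. *)

Definition is_prime_power (q : nat) : Prop :=
  exists r k : nat, prime r /\ (0 < k)%N /\ q = (r ^ k)%N.

Definition Nc (L T : nat) (p : nat -> nat) (i : nat) : nat :=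
  (p i + 2 * L + 2 * T - 2)%N.

Definition npts (L T : nat) (p : nat -> nat) : nat := (Nc L T p L + L)%N.

Definition is_subfield (F : finFieldType) (E : {set F}) : bool :=
  [&& (0 : F) \in E, (1 : F) \in E,
      [forall x in E, [forall y in E, (x - y \in E) && (x * y \in E)]]
    & [forall x in E, x^-1 \in E]].

(* F_{q0} inside F_q: the unique subfield of order q0, i.e. {x | x^q0 = x}. *)
Definition base_field (F : finFieldType) (q0 : nat) : {set F} :=
  [set x : F | x ^+ q0 == x].

Definition gen_field (F : finFieldType) (K S : {set F}) : {set F} :=
  \bigcap_(E : {set F} | [&& is_subfield E, K \subset E & S \subset E]) E.

(* Degree [E : K] of an extension of finite fields K <= E: the d with
   |E| = |K|^d. *)
Definition ext_deg (F : finFieldType) (K E : {set F}) : nat :=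
  trunc_log #|K| #|E|.

Definition ftrace (F : finFieldType) (E : {set F}) (x : F) : F :=
  \sum_(k < ext_deg E [set: F]) x ^+ (#|E| ^ k)%N.

Definition Fi (F : finFieldType) (q0 L : nat) (alpha : nat -> F) (i : nat)
  : {set F} :=
  gen_field (base_field F q0)
    [set x : F | [exists j : 'I_L.+1,
        [&& (0 < j)%N, (j != i :> nat) & x == alpha j]]].

Definition lagr (F : fieldType) (alpha : nat -> F) (K k : nat) (x : F) : F :=
  \prod_(1 <= m < K.+1 | m != k) ((x - alpha m) / (alpha k - alpha m)).

(* value at x of the (unique) polynomial of degree <= K-1 (with coefficients
   in the F-vector space V) taking the value val k at alpha k, k in [1, K] *)
Definition interp (F : fieldType) (V : lmodType F) (alpha : nat -> F)
  (K : nat) (val : nat -> V) (x : F) : V :=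
  \sum_(1 <= k < K.+1) lagr alpha K k x *: val k.

(* blocks: A = [A_1 ... A_L], B^T = [B_1^T ... B_L^T], blocks of width k = b/L *)
Definition Ablock (F : fieldType) (a b k : nat) (A : 'M[F]_(a, b)) (i : nat)
  : 'M[F]_(a, k) :=
  \matrix_(r < a, s < k)
     match insub ((i.-1) * k + s)%N with Some t => A r t | None => 0 end.

Definition Bblock (F : fieldType) (b c k : nat) (B : 'M[F]_(b, c)) (i : nat)
  : 'M[F]_(k, c) :=
  \matrix_(r < k, s < c)
     match insub ((i.-1) * k + r)%N with Some t => B t s | None => 0 end.

(* the random masks R_1..R_T, S_1..S_T (R_j = RS.1 (j-1)) *)
Definition masks_t (F : finFieldType) (a k c T : nat) : finType :=
  ({ffun 'I_T -> 'M[F]_(a, k)} * {ffun 'I_T -> 'M[F]_(k, c)})%type.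

Definition maskR (F : finFieldType) (a k c T : nat) (RS : masks_t F a k c T)
  (j : nat) : 'M[F]_(a, k) :=
  match insub j.-1 with Some t => RS.1 t | None => 0 end.

Definition maskS (F : finFieldType) (a k c T : nat) (RS : masks_t F a k c T)
  (j : nat) : 'M[F]_(k, c) :=
  match insub j.-1 with Some t => RS.2 t | None => 0 end.

Definition ftp_f (F : finFieldType) (L T a b c : nat) (alpha : nat -> F)
  (A : 'M[F]_(a, b)) (RS : masks_t F a (b %/ L) c T) (x : F)
  : 'M[F]_(a, b %/ L) :=
  interp alpha (L + T)
    (fun k => if (k <= L)%N then Ablock (b %/ L) A k else maskR RS (k - L)) x.

Definition ftp_g (F : finFieldType) (L T a b c : nat) (alpha : nat -> F)
  (B : 'M[F]_(b, c)) (RS : masks_t F a (b %/ L) c T) (x : F)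
  : 'M[F]_(b %/ L, c) :=
  interp alpha (L + T)
    (fun k => if (k <= L)%N then Bblock (b %/ L) B k else maskS RS (k - L)) x.

Definition upload (F : finFieldType) (L T a b c : nat) (alpha : nat -> F)
  (A : 'M[F]_(a, b)) (B : 'M[F]_(b, c)) (RS : masks_t F a (b %/ L) c T)
  (j : nat) : ('M[F]_(a, b %/ L) * 'M[F]_(b %/ L, c))%type :=
  (ftp_f alpha A RS (alpha (L + j)%N), ftp_g alpha B RS (alpha (L + j)%N)).

Definition vcoef (F : fieldType) (n : nat) (alpha : nat -> F) (j : nat) : F :=
  \prod_(1 <= i < n.+1 | i != j) (alpha j - alpha i)^-1.

Definition kpoly (F : fieldType) (n L Ni : nat) (alpha : nat -> F) (i : nat)
  (x : F) : F :=
  \prod_(1 <= j < n.+1 | ~~ ((L < j <= L + Ni)%N || (j == i))) (x - alpha j).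

(* download: for i in [L] and server j in [N_i], server j sends
   tr_{F_q/F_i}(v_{L+j} k_i(alpha_{L+j}) h(alpha_{L+j})), with
   h(alpha_{L+j}) = f(alpha_{L+j}) g(alpha_{L+j}) computed by server j;
   responses outside that range are set to 0 (nothing is sent). *)
Definition response (F : finFieldType) (L T q0 a b c : nat) (p : nat -> nat)
  (alpha : nat -> F) (A : 'M[F]_(a, b)) (B : 'M[F]_(b, c))
  (RS : masks_t F a (b %/ L) c T) (i j : nat) : 'M[F]_(a, c) :=
  if [&& (1 <= i <= L)%N & (1 <= j <= Nc L T p i)%N] then
    let u := upload alpha A B RS j in
    let h := u.1 *m u.2 in
    map_mx (ftrace (Fi q0 L alpha i))
      ((vcoef (npts L T p) alpha (L + j)%N
        * kpoly (npts L T p) L (Nc L T p i) alpha i (alpha (L + j)%N)) *: h)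
  else 0.

(* mutual information of a joint probability mass function P on X x Y
   (with the convention 0 log 0 = 0) *)
Definition mutual_info (R : realType) (X Y : finType) (P : X -> Y -> R) : R :=
  \sum_(x : X) \sum_(y : Y)
     (if P x y == 0 then 0
      else P x y * ln (P x y / ((\sum_(y' : Y) P x y') * (\sum_(x' : X) P x' y)))).

Definition pmf (R : realType) (X : finType) (P : X -> R) : Prop :=
  (forall x, 0 <= P x) /\ \sum_(x : X) P x = 1.

Definition view (F : finFieldType) (L T a b c : nat) (alpha : nat -> F)
  (s : seq nat) (A : 'M[F]_(a, b)) (B : 'M[F]_(b, c))
  (RS : masks_t F a (b %/ L) c T)
  : {ffun 'I_T -> ('M[F]_(a, b %/ L) * 'M[F]_(b %/ L, c))} :=
  [ffun t : 'I_T => upload alpha A B RS (nth 0%N s t)].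

(* joint law of ((A,B), view) when (A,B) ~ pAB and the masks R_1..R_T, S_1..S_T
   are independent and uniform, independent of (A,B) *)
Definition joint_AB_view (R : realType) (F : finFieldType) (L T a b c : nat)
  (alpha : nat -> F) (s : seq nat) (pAB : ('M[F]_(a, b) * 'M[F]_(b, c)) -> R)
  (x : ('M[F]_(a, b) * 'M[F]_(b, c)))
  (y : {ffun 'I_T -> ('M[F]_(a, b %/ L) * 'M[F]_(b %/ L, c))}) : R :=
  pAB x * ((#|[set RS : masks_t F a (b %/ L) c T |
                 view alpha s x.1 x.2 RS == y]|)%:R
           / (#|[set: masks_t F a (b %/ L) c T]|)%:R).

Definition T_secure (R : realType) (F : finFieldType) (L T a b c : nat)
  (NL : nat) (alpha : nat -> F) : Prop :=
  forall pAB : ('M[F]_(a, b) * 'M[F]_(b, c)) -> R, pmf pAB ->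
  forall s : seq nat, uniq s -> size s = T -> all (fun j => 1 <= j <= NL)%N s ->
    mutual_info (joint_AB_view (L:=L) (T:=T) alpha s pAB) = 0.

(* Communication cost, in F_{q0}-symbols: an element of F_q counts as
   p_1...p_L symbols, an element of F_i as prod_{j<>i} p_j symbols. *)

Definition sym_Fq (L : nat) (p : nat -> nat) : nat := \prod_(1 <= j < L.+1) p j.
Definition sym_Fi (L : nat) (p : nat -> nat) (i : nat) : nat :=
  \prod_(1 <= j < L.+1 | j != i) p j.

(* upload: each of the N_L servers receives an a x (b/L) and a (b/L) x c
   matrix over F_q *)
Definition upload_symbols (L T a b c : nat) (p : nat -> nat) : nat :=
  (Nc L T p L * (a * (b %/ L) + (b %/ L) * c) * sym_Fq L p)%N.

(* download: for each i in [L], each of the servers 1..N_i sends an a x c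
   matrix over F_i *)
Definition download_symbols (L T a c : nat) (p : nat -> nat) : nat :=
  (\sum_(1 <= i < L.+1) Nc L T p i * (a * c) * sym_Fi L p i)%N.

Definition total_rate (L T a b c : nat) (p : nat -> nat) : rat :=
  ((a * c * sym_Fq L p)%N)%:R /
  ((upload_symbols L T a b c p + download_symbols L T a c p)%N)%:R.

(* Main.v *)
(* For each i, the points [alpha j] with L < j lie in F_i, so applying the trace to
   F_i to the dual Reed-Solomon relation for h k_i x^m expresses through the responses
   the values tr (alpha_i^m v_i k_i(alpha_i) h(alpha_i)) for all m < p_i.  Since F_q
   has prime degree p_i over F_i and alpha_i is not in F_i, these p_i traces determine
   h(alpha_i) = A_i B_i.  Security is a counting argument: the views of T servers
   depend bijectively on the masks, because a polynomial of degree < L + T is fixed by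
   its values at the L data points and any T server points. *)
Require Import Defs.
From HB Require Import structures.
From mathcomp Require Import all_boot all_order all_algebra.
From mathcomp Require Import fingroup finfield.
From mathcomp Require Import reals exp.
From mathcomp Require Import zify ring.
Set Implicit Arguments.
Unset Strict Implicit.
Unset Printing Implicit Defensive.

Import Order.TTheory GRing.Theory Num.Theory.
Local Open Scope ring_scope.

(** * Fixed points of power maps and the order of the base field *)

Lemma iter_exp_fixed {F : fieldType} (Q a u : nat) (x : F) :
  x ^+ (Q ^ a) = x -> x ^+ (Q ^ (u * a)) = x.
Proof.
move=> xa; elim: u => [|u IH]; first by rewrite mul0n expn0 expr1.
by rewrite mulSn expnD exprM xa IH.
Qed.

(** Bezout gives [u * a = v * b + gcdn a b]; evaluating [x ^+ (Q ^ (u * a))] through either side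
    leaves [x] and [x ^+ (Q ^ gcdn a b)]. *)
Lemma gcd_exp_fixed {F : fieldType} (Q a b : nat) (x : F) :
  (0 < a)%N -> x ^+ (Q ^ a) = x -> x ^+ (Q ^ b) = x -> x ^+ (Q ^ gcdn a b) = x.
Proof.
move=> a0 xa xb; case: (egcdnP b a0) => u v uv _.
have := iter_exp_fixed u xa.
by rewrite uv expnD exprM (iter_exp_fixed v xb).
Qed.

(** Elements of [E] are roots of [X^Q - X], which has degree [Q]. All upper bounds on subfields
    below come from this. *)
Lemma card_exp_fixed_le {F : finFieldType} (Q : nat) (E : {set F}) :
  (1 < Q)%N -> {in E, forall x, x ^+ Q = x} -> (#|E| <= Q)%N.
Proof.
move=> Q1 EQ.
have szP : size ('X^Q - 'X : {poly F}) = Q.+1.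
  by rewrite size_polyDl size_polyXn // size_polyN size_polyX.
rewrite -ltnS -szP cardE; apply: max_poly_roots (enum_uniq _).
  by rewrite -size_poly_eq0 szP.
apply/allP => x; rewrite mem_enum => /EQ xQ.
by rewrite /root !hornerE xQ subrr.
Qed.

(** By induction: with [y = X^(Q^m)], the difference [y^Q - X^Q] is a multiple of [y - X]. *)
Lemma dvdp_expXn_sub {F : fieldType} (Q m : nat) :
  ('X^Q - 'X : {poly F}) %| 'X^(Q ^ m) - 'X.
Proof.
elim: m => [|m IH]; first by rewrite expn0 expr1 subrr dvdp0.
have -> : 'X^(Q ^ m.+1) - 'X =
   (('X^(Q ^ m)) ^+ Q - 'X^Q) + ('X^Q - 'X) :> {poly F}.
  by rewrite -exprM -expnSr addrA subrK.
rewrite dvdp_add // subrXX; exact: dvdp_mulr.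
Qed.

(** Every element of [F] is a root of [X^(q0^m) - X = g (X^q0 - X)]. Those outside the base field
    are roots of [g], whose degree is [q0^m - q0], so at least [q0] elements remain inside. *)
Lemma card_base_field {F : finFieldType} (q0 m : nat) :
  (1 < q0)%N -> (0 < m)%N -> #|F| = (q0 ^ m)%N -> #|base_field F q0| = q0.
Proof.
move=> q1 m0 cF; apply/eqP; rewrite eqn_leq; apply/andP; split.
  by apply: card_exp_fixed_le => // x; rewrite inE => /eqP.
have /dvdpP [g Eg] := @dvdp_expXn_sub F q0 m.
have szp k : (1 < k)%N -> size ('X^k - 'X : {poly F}) = k.+1.
  by move=> k1; rewrite size_polyDl size_polyXn // size_polyN size_polyX.
have qm1 : (1 < q0 ^ m)%N by rewrite -(expn0 q0) ltn_exp2l.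
have nz : ('X^(q0 ^ m) - 'X : {poly F}) != 0 by rewrite -size_poly_eq0 szp.
have [gnz pnz] : g != 0 /\ ('X^q0 - 'X : {poly F}) != 0.
  by move: nz; rewrite Eg mulf_eq0 negb_or => /andP.
have szg : (size g + q0 = (q0 ^ m).+1)%N.
  by rewrite -(szp _ qm1) Eg size_mul // szp // addnS.
have cg : (#|~: base_field F q0| < size g)%N.
  rewrite cardE; apply: max_poly_roots (enum_uniq _) => //.
  apply/allP => x; rewrite mem_enum !inE => xn.
  have : root ('X^(q0 ^ m) - 'X) x by rewrite /root !hornerE -cF expf_card subrr.
  rewrite Eg rootM => /orP[] //.
  by rewrite /root !hornerE subr_eq0 (negPf xn).
have := cardsC (base_field F q0); rewrite cF => cc.
lia.
Qed.

(** * Subfields of a finite field and their cardinalities *)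

Section Subfields.
Variable F : finFieldType.
Implicit Types (E K S : {set F}) (x y : F).

Lemma is_subfieldP E :
  reflect [/\ 0 \in E, 1 \in E,
     {in E &, forall x y, (x - y \in E) /\ (x * y \in E)}
     & {in E, forall x, x^-1 \in E}] (is_subfield E).
Proof.
apply: (iffP and4P) => [[E0 E1 /forall_inP EBM /forall_inP EV]|[E0 E1 EBM EV]].
  split=> // x y xE yE; apply/andP.
  by have /forall_inP := EBM x xE; apply.
split=> //; last exact/forall_inP.
apply/forall_inP => x xE; apply/forall_inP => y yE.
exact/andP/EBM.
Qed.

Lemma subfield_card_gt1 E : is_subfield E -> (1 < #|E|)%N.
Proof.
case/is_subfieldP=> E0 E1 _ _; rewrite (cardsD1 0) E0 (cardsD1 1).
by rewrite in_setD1 E1 oner_neq0.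
Qed.

(** Multiplication by a nonzero [x] permutes the nonzero elements of [E]; comparing their product
    [P] before and after gives [x ^+ (#|E| - 1) = 1]. *)
Lemma subfield_expf_card E x : is_subfield E -> x \in E -> x ^+ #|E| = x.
Proof.
move=> sE xE; have [E0 E1 EBM EV] := is_subfieldP _ sE.
have [->|x0] := eqVneq x 0.
  by rewrite expr0n; case: #|E| (subfield_card_gt1 sE).
pose P := \prod_(y in E :\ 0) y.
have P0 : P != 0.
  by apply/prodf_neq0 => y; rewrite in_setD1 => /andP[].
have PE : P = x ^+ #|E :\ 0| * P.
  rewrite /P {1}(reindex_onto (fun y => x * y) (fun y => x^-1 * y)) /=; last first.
    by move=> y _; rewrite mulVKf.
  rewrite -prodr_const -big_split /=; apply: eq_bigl => y.
  rewrite mulKf // eqxx andbT !in_setD1 mulf_eq0 negb_or x0 /=; congr andb.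
  apply/idP/idP => [xyE|yE]; last exact: (EBM _ _ xE yE).2.
  by rewrite -[y](mulKf x0); apply: (EBM _ _ (EV _ xE) xyE).2.
have x1 : x ^+ #|E :\ 0| = 1.
  by apply: (mulIf P0); rewrite -PE mul1r.
by rewrite (cardsD1 0) E0 exprD expr1 x1 mulr1.
Qed.

(** A fixed point outside [E] would give [X^#|E| - X] one root too many. *)
Lemma mem_subfield_expf E x : is_subfield E -> (x \in E) = (x ^+ #|E| == x).
Proof.
move=> sE; apply/idP/eqP => [|xE]; first exact: subfield_expf_card.
apply/negPn/negP => xnE.
have : (#|x |: E| <= #|E|)%N.
  apply: card_exp_fixed_le; first exact: subfield_card_gt1.
  by move=> y /setU1P[->|/(subfield_expf_card sE)].
by rewrite cardsU1 xnE add1n ltnn.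
Qed.

(** Lagrange's theorem in the additive group of [F]. *)
Lemma subfield_card_dvd E : is_subfield E -> (#|E| %| #|F|)%N.
Proof.
case/is_subfieldP=> E0 _ EBM _.
have gE : group_set (E : {set FinRing.Field_to_finGroup F}).
  apply/group_setP; split=> // x y xE yE.
  have -> : (x * y)%g = (x - (0 - y) : F) by rewrite sub0r opprK.
  by apply: (EBM _ _ xE _).1; apply: (EBM _ _ E0 yE).1.
by rewrite -cardsT; apply: (@cardSg _ [group of [set: _]] (Group gE)); apply/subsetP => x.
Qed.

(** Both orders are powers [r^m] and [r^m'] of the characteristic. Elements of [E] are fixed by both
    power maps, hence by the one for [r ^ gcdn m m']; counting roots forces [m <= gcdn m m'], so [m]
    divides [m']. *)
Lemma card_subfield_ext E E' :
  is_subfield E -> is_subfield E' -> E \subset E' ->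
  exists d, #|E'| = (#|E| ^ d)%N.
Proof.
move=> sE sE' EE'; have [r rP rF] := finPcharP F.
pose M := logn r #|F|.
have cF : #|F| = (r ^ M)%N := card_pprimeChar rF.
have /(dvdn_pfactor _ _ rP)[m _ cE] : (#|E| %| r ^ M)%N.
  by rewrite -cF subfield_card_dvd.
have /(dvdn_pfactor _ _ rP)[m' _ cE'] : (#|E'| %| r ^ M)%N.
  by rewrite -cF subfield_card_dvd.
have r1 := prime_gt1 rP.
have m0 : (0 < m)%N.
  by have := subfield_card_gt1 sE; rewrite cE; case: m {cE}.
have mg : (m <= gcdn m m')%N.
  rewrite -(leq_exp2l _ _ r1) -cE; apply: card_exp_fixed_le.
    by rewrite -(expn0 r) ltn_exp2l // gcdn_gt0 m0.
  move=> x xE; apply: gcd_exp_fixed => //.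
    by rewrite -cE subfield_expf_card.
  by rewrite -cE' subfield_expf_card // (subsetP EE').
have /dvdnP[d md] : (m %| m')%N.
  suff -> : m = gcdn m m' by rewrite dvdn_gcdr.
  by apply/eqP; rewrite eqn_leq mg dvdn_leq // dvdn_gcdl.
by exists d; rewrite cE cE' -expnM mulnC -md.
Qed.

Lemma is_subfieldT : is_subfield [set: F].
Proof. by apply/is_subfieldP; split=> [||x y|x]; rewrite !inE. Qed.

Lemma base_field_subfield Q : [char F].-nat Q -> is_subfield (base_field F Q).
Proof.
move=> QF; have Q0 : (0 < Q)%N by case/andP: QF.
apply/is_subfieldP; split=> [||x y|x]; rewrite ?inE.
- by rewrite expr0n eqn0Ngt Q0.
- by rewrite expr1n.
- move=> /eqP xQ /eqP yQ; rewrite exprMn xQ yQ eqxx; split=> //.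
  have := exprDn_pchar (x - y) y QF; rewrite subrK xQ yQ => xE.
  by rewrite [X in _ == X - y]xE addrK.
- by move=> /eqP xQ; rewrite exprVn xQ.
Qed.

Lemma gen_field_subfield K S : is_subfield (gen_field K S).
Proof.
apply/is_subfieldP; split.
- by apply/bigcapP => E /and3P[/is_subfieldP[]].
- by apply/bigcapP => E /and3P[/is_subfieldP[]].
- move=> x y /bigcapP xE /bigcapP yE.
  split; apply/bigcapP => E EP; have /and3P[/is_subfieldP[_ _ EBM _] _ _] := EP.
    exact: (EBM _ _ (xE _ EP) (yE _ EP)).1.
  exact: (EBM _ _ (xE _ EP) (yE _ EP)).2.
- move=> x /bigcapP xE; apply/bigcapP => E EP.
  by have /and3P[/is_subfieldP[_ _ _ EV] _ _] := EP; apply/EV/xE.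
Qed.

Lemma sub_gen_fieldl K S : K \subset gen_field K S.
Proof. by apply/bigcapsP => E /and3P[]. Qed.

Lemma sub_gen_fieldr K S : S \subset gen_field K S.
Proof. by apply/bigcapsP => E /and3P[]. Qed.

Lemma gen_field_sub K S E :
  is_subfield E -> K \subset E -> S \subset E -> gen_field K S \subset E.
Proof. by move=> sE KE SE; apply: bigcap_inf; rewrite sE KE. Qed.

(** The truncated logarithm in [ext_deg] is exact here, because [#|E|] is a genuine power of
    [#|K|]. *)
Lemma card_ext_deg K E : is_subfield K -> is_subfield E -> K \subset E ->
  #|E| = (#|K| ^ ext_deg K E)%N.
Proof.
move=> sK sE KE; have [d cE] := card_subfield_ext sK sE KE.
by rewrite /ext_deg cE trunc_expnK // subfield_card_gt1.
Qed.

Lemma subfield_card_pnat E : is_subfield E -> [char F].-nat #|E|.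
Proof.
move=> sE; have [r rP rF] := finPcharP F.
have := subfield_card_dvd sE; rewrite (card_pprimeChar rF).
move=> /(dvdn_pfactor _ _ rP)[m _ ->].
by rewrite pnatX pnatE // rF.
Qed.

(** * The trace onto a subfield *)

Lemma ftraceD E x y : is_subfield E -> ftrace E (x + y) = ftrace E x + ftrace E y.
Proof.
move=> sE; rewrite /ftrace -big_split /=; apply: eq_bigr => k _.
by rewrite exprDn_pchar // pnatX subfield_card_pnat.
Qed.

Lemma ftraceB E x y : is_subfield E -> ftrace E (x - y) = ftrace E x - ftrace E y.
Proof. by move=> sE; apply: (addIr (ftrace E y)); rewrite -ftraceD // !subrK. Qed.

Lemma ftraceZ E x y : is_subfield E -> x \in E -> ftrace E (x * y) = x * ftrace E y.
Proof.
move=> sE xE; rewrite /ftrace big_distrr /=; apply: eq_bigr => k _.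
have := @iter_exp_fixed F #|E| 1 k x; rewrite muln1 expn1 => xk.
by rewrite exprMn xk // subfield_expf_card.
Qed.

Lemma ftrace0 E : is_subfield E -> ftrace E 0 = 0.
Proof.
move=> sE; rewrite -[X in ftrace _ X](mul0r 0) ftraceZ ?mul0r //.
by case/is_subfieldP: sE.
Qed.

Lemma ftrace_sum E (I : Type) (r : seq I) (P : pred I) (f : I -> F) :
  is_subfield E ->
  ftrace E (\sum_(i <- r | P i) f i) = \sum_(i <- r | P i) ftrace E (f i).
Proof.
by move=> sE; apply: big_morph => [x y|]; [apply: ftraceD|apply: ftrace0].
Qed.

(** Raising to the power [#|E|] shifts the summands cyclically: the last one becomes
    [x ^+ #|F| = x], which is the first. *)
Lemma ftrace_mem E x : is_subfield E -> ftrace E x \in E.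
Proof.
move=> sE; rewrite mem_subfield_expf //; apply/eqP.
have sumX (r : seq nat) (f : nat -> F) :
    (\sum_(k <- r) f k) ^+ #|E| = \sum_(k <- r) f k ^+ #|E|.
  apply: (big_morph (fun x => x ^+ #|E|)) => [y z|].
    by rewrite exprDn_pchar // subfield_card_pnat.
  by rewrite expr0n; case: #|E| (subfield_card_gt1 sE).
have cF := card_ext_deg sE is_subfieldT (subsetT E).
rewrite /ftrace -(big_mkord predT (fun k => x ^+ (#|E| ^ k))) sumX.
case: (ext_deg _ _) cF => [|d] cF; first by rewrite !big_nil.
rewrite big_nat_recr // big_nat_recl //= -exprM -expnSr -cF cardsT expf_card.
rewrite expn0 expr1 addrC; congr (_ + _); apply: eq_bigr => k _.
by rewrite -exprM -expnSr.
Qed.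

(* The trace form against powers of [x] is a Vandermonde system in the conjugates
   of [z]; pairing it with the coefficients of the polynomial whose roots are the
   nontrivial conjugates of [x] isolates [z]. *)
Lemma ftrace_exp_eq0 E x z :
  is_subfield E -> prime (ext_deg E [set: F]) -> x \notin E ->
  (forall m, (m < ext_deg E [set: F])%N -> ftrace E (x ^+ m * z) = 0) -> z = 0.
Proof.
move=> sE dP xE tr0.
have cF := card_ext_deg sE is_subfieldT (subsetT E).
rewrite cardsT in cF.
set d := ext_deg _ _ in dP tr0 cF.
have d0 := prime_gt0 dP.
pose P : {poly F} := \prod_(y <- [seq x ^+ (#|E| ^ k) | k <- iota 1 d.-1]) ('X - y%:P).
have szP : size P = d by rewrite size_prod_XsubC size_map size_iota prednK.
(* If [x] equalled its conjugate of index [k] with [0 < k < d], then, [k] being coprime to the prime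
   [d], the gcd argument would give [x ^+ #|E| = x] and put [x] in [E]. *)
have Px : P.[x] != 0.
  rewrite -[_ == 0]/(root P x) root_prod_XsubC; apply/mapP => -[k].
  rewrite mem_iota add1n prednK // => /andP[k0 kd] xk.
  move/negP: xE; apply; rewrite mem_subfield_expf //.
  have := gcd_exp_fixed k0 (esym xk) (etrans (congr1 (GRing.exp x) (esym cF)) (expf_card x)).
  suff /eqP -> : coprime k d by rewrite expn1 => ->.
  by rewrite coprime_sym prime_coprime // gtnNdvd.
(* After exchanging the sums, the conjugate of index [k] of [z] carries the factor
   [P.[x ^+ (#|E| ^ k)]], which vanishes unless [k = 0]. *)
have : \sum_(m < d) P`_m * ftrace E (x ^+ m * z) = P.[x] * z.
  under eq_bigr do rewrite /ftrace -/d big_distrr /=.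
  rewrite exchange_big /= (bigD1 (Ordinal d0)) //= [X in _ + X]big1 ?addr0.
    under eq_bigr do rewrite expn0 expr1 mulrA.
    by rewrite -big_distrl /= -szP -horner_coef.
  move=> k k0; under eq_bigr do rewrite exprMn -exprM mulnC exprM mulrA.
  rewrite -big_distrl /=.
  have := @horner_coef _ P (x ^+ (#|E| ^ k)); rewrite szP => <-.
  suff /rootP -> : root P (x ^+ (#|E| ^ k)) by rewrite mul0r.
  rewrite root_prod_XsubC; apply: map_f.
  by rewrite mem_iota add1n prednK // ltn_ord andbT lt0n.
rewrite big1 => [/esym/eqP|m _]; last by rewrite tr0 // mulr0.
by rewrite mulf_eq0 (negPf Px) => /eqP.
Qed.

End Subfields.

(** * Degrees of the fields generated by the evaluation points *)

Section FtpFields.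
Variables (F : finFieldType) (L q0 : nat) (p : nat -> nat) (alpha : nat -> F).
Hypothesis p_prime : forall i, (1 <= i <= L)%N -> prime (p i).
Hypothesis p_inc :
  forall i j, (1 <= i)%N -> (i < j)%N -> (j <= L)%N -> (p i < p j)%N.
Hypothesis q0_pp : is_prime_power q0.
Hypothesis card_F : #|F| = (q0 ^ (\prod_(1 <= i < L.+1) p i))%N.
Hypothesis deg_alpha : forall i, (1 <= i <= L)%N ->
  ext_deg (base_field F q0) (gen_field (base_field F q0) [set alpha i]) = p i.

Let D i := (\prod_(1 <= j < L.+1 | j != i) p j)%N.
Let K := base_field F q0.
Let G i := gen_field K [set alpha i].

Let p_inj i j : (1 <= i <= L)%N -> (1 <= j <= L)%N -> p i = p j -> i = j.
Proof.
move=> /andP[i1 iL] /andP[j1 jL] pij; case: (ltngtP i j) => // ij.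
  by have := p_inc i1 ij jL; rewrite pij ltnn.
by have := p_inc j1 ij iL; rewrite pij ltnn.
Qed.

Let q0_gt1 : (1 < q0)%N.
Proof.
case: q0_pp => r [k [rP [k0 ->]]].
by rewrite -(expn0 r) ltn_exp2l // prime_gt1.
Qed.

Lemma prod_prime_gt0 (Q : pred nat) : (0 < \prod_(1 <= j < L.+1 | Q j) p j)%N.
Proof.
rewrite big_nat_cond; apply: prodn_cond_gt0 => j /andP[jL _].
exact/prime_gt0/p_prime.
Qed.

Let q0_pnat : [char F].-nat q0.
Proof.
have [r [k [rP [k0 Eq]]]] := q0_pp.
have rF : r \in [char F].
  by apply: card_finPcharP rP; rewrite card_F Eq -expnM.
by rewrite Eq pnatX pnatE // rF.
Qed.

Let sK : is_subfield K.
Proof. exact: base_field_subfield q0_pnat. Qed.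

Let cK : #|K| = q0.
Proof. exact: card_base_field q0_gt1 (prod_prime_gt0 _) card_F. Qed.

Let cG i : (1 <= i <= L)%N -> #|G i| = (q0 ^ p i)%N.
Proof.
move=> iL; rewrite -(deg_alpha iL) -{1}cK.
by apply: card_ext_deg => //; [exact: gen_field_subfield|exact: sub_gen_fieldl].
Qed.

Lemma Fi_subfield i : is_subfield (Fi q0 L alpha i).
Proof. exact: gen_field_subfield. Qed.

Lemma base_field_sub_Fi i : K \subset Fi q0 L alpha i.
Proof. exact: sub_gen_fieldl. Qed.

Lemma alpha_mem_Fi i j : (1 <= j <= L)%N -> j != i -> alpha j \in Fi q0 L alpha i.
Proof.
move=> /andP[j0 jL] ji; apply: (subsetP (sub_gen_fieldr _ _)).
by rewrite inE; apply/existsP; exists (Ordinal (jL : j < L.+1)%N); rewrite j0 ji /=.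
Qed.

(** The field generated by [alpha j] has order [q0 ^ p j] and sits inside [Fi], so the order of [Fi]
    is a power of [q0 ^ p j]. *)
Let dvd_Fi i j m : (1 <= j <= L)%N -> #|Fi q0 L alpha i| = (q0 ^ m)%N ->
  alpha j \in Fi q0 L alpha i -> (p j %| m)%N.
Proof.
move=> jL cE aE.
have GE : G j \subset Fi q0 L alpha i.
  apply: gen_field_sub (Fi_subfield i) (base_field_sub_Fi i) _.
  by rewrite sub1set.
have [e] := card_subfield_ext (gen_field_subfield _ _) (Fi_subfield i) GE.
rewrite cE cG // -expnM => /eqP; rewrite eqn_exp2l // => /eqP ->.
exact: dvdn_mulr.
Qed.

Let ndvd_D i : (1 <= i <= L)%N -> ~~ (p i %| D i)%N.
Proof.
move=> iL; rewrite Euclid_dvd_prod ?p_prime //.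
rewrite big_nat_cond; apply: (big_ind (fun b => ~~ b)) => //[x y xn yn|j /andP[jL ji]].
  by rewrite negb_or xn.
rewrite dvdn_prime2 ?p_prime //; apply/eqP => pij.
by move/eqP: ji; apply; apply: p_inj.
Qed.

Lemma card_Fi i : (1 <= i <= L)%N ->
  #|Fi q0 L alpha i| = (q0 ^ \prod_(1 <= j < L.+1 | j != i) p j)%N.
Proof.
move=> iL; have := card_ext_deg sK (Fi_subfield i) (base_field_sub_Fi i).
rewrite cK; set m := ext_deg _ _ => cE.
rewrite cE; congr (_ ^ _)%N; apply/eqP; rewrite eqn_leq -/(D i).
have D0 : (0 < D i)%N by exact: prod_prime_gt0.
have m0 : (0 < m)%N.
  by have := subfield_card_gt1 (Fi_subfield i); rewrite cE; case: (m).
apply/andP; split.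
  (* Upper bound: every generator [alpha j] is fixed by the power [q0 ^ p j], hence by [q0 ^ D i]
     since [p j] divides [D i]. So [Fi] lies in the fixed field of that power. *)
  rewrite -(leq_exp2l _ _ q0_gt1) -cE; apply: card_exp_fixed_le.
    by rewrite -(expn0 q0) ltn_exp2l.
  move=> x xE; apply/eqP; suff : x \in base_field F (q0 ^ D i) by rewrite inE.
  move: x xE; apply/subsetP; apply: gen_field_sub.
  - by apply: base_field_subfield; rewrite pnatX q0_pnat.
  - apply/subsetP => x; rewrite !inE => /eqP xK.
    by have := @iter_exp_fixed F q0 1 (D i) x; rewrite muln1 expn1 => ->.
  - apply/subsetP => x; rewrite !inE => /existsP[[j jL] /= /and3P[j0 ji /eqP->]].
    have jL' : (1 <= j <= L)%N by rewrite j0 -ltnS.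
    have /dvdnP[u ->] : (p j %| D i)%N.
      rewrite /D -big_filter (bigD1_seq j) /= ?dvdn_mulr //.
        by rewrite mem_filter ji mem_index_iota.
      by rewrite filter_uniq // iota_uniq.
    rewrite iter_exp_fixed // -cG // subfield_expf_card //.
      exact: gen_field_subfield.
    by apply: (subsetP (sub_gen_fieldr _ _)); rewrite inE.
(* Lower bound: each [p j] with [j != i] divides [m], and these distinct primes are pairwise
   coprime, so their product divides [m]. *)
rewrite dvdn_leq //; apply/unstable.Gauss_dvd_prod.
  rewrite pairwise_map; apply: (@sub_in_pairwise _ [pred j | 1 <= j <= L]%N
    [rel j k | j != k]).
  - move=> j k jL kL /= jk; rewrite prime_coprime ?p_prime //.
    by rewrite dvdn_prime2 ?p_prime //; apply: contra jk => /eqP/(p_inj jL kL)->.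
  - by apply/allP => j; rewrite mem_filter mem_index_iota => /andP[].
  - by rewrite -uniq_pairwise filter_uniq // iota_uniq.
move=> j; rewrite mem_index_iota => jL ji.
by apply: dvd_Fi cE _ => //; apply: alpha_mem_Fi.
Qed.

(** Membership would make [p i] divide the product of the other primes. *)
Lemma alpha_notin_Fi i : (1 <= i <= L)%N -> alpha i \notin Fi q0 L alpha i.
Proof.
move=> iL; apply/negP => /(dvd_Fi iL (card_Fi iL)).
exact/negP/ndvd_D.
Qed.

Lemma ext_deg_Fi i : (1 <= i <= L)%N -> ext_deg (Fi q0 L alpha i) [set: F] = p i.
Proof.
move=> iL; have := card_ext_deg (Fi_subfield i) (is_subfieldT F) (subsetT _).
rewrite cardsT card_F {1}card_Fi // -expnM => /eqP; rewrite eqn_exp2l //.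
rewrite (bigD1_seq i) ?mem_index_iota ?iota_uniq //= mulnC eqn_pmul2l.
  by move=> /eqP.
exact: prod_prime_gt0.
Qed.

(** For [i <= L], every other point lies in [Fi] while [alpha i] does not, so [alpha i] differs from
    all of them. *)
Lemma alpha_inj n i j :
  (forall j, (L < j <= n)%N -> alpha j \in base_field F q0) ->
  (forall j k, (L < j <= n)%N -> (L < k <= n)%N -> alpha j = alpha k -> j = k) ->
  (1 <= i <= n)%N -> (1 <= j <= n)%N -> alpha i = alpha j -> i = j.
Proof.
move=> aK ainj; move: i j.
suff H i j : (1 <= i <= L)%N -> (1 <= j <= n)%N -> alpha i = alpha j -> i = j.
  move=> i j /andP[i1 iN] /andP[j1 jN] aij.
  have [iL|iL] := leqP i L; first by apply: H; rewrite ?i1 ?j1.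
  have [jL|jL] := leqP j L; first by apply/esym/H; rewrite ?i1 ?j1.
  by apply: ainj; rewrite ?iL ?jL.
move=> iL /andP[j1 jN] aij; apply/eqP/negPn/negP => ij.
have /negP := alpha_notin_Fi iL; apply; rewrite aij.
have [jL|jL] := leqP j L; first by apply: alpha_mem_Fi; rewrite ?j1 // eq_sym.
by apply: (subsetP (base_field_sub_Fi i)); apply: aK; rewrite jL.
Qed.

End FtpFields.

(** * Lagrange interpolation and duality of Reed-Solomon codes *)

Section Interpolation.
Variables (F : fieldType) (alpha : nat -> F) (n : nat).
Hypothesis alpha_inj : {in [pred i | 1 <= i <= n]%N &, injective alpha}.

(** The Lagrange basis polynomial with its denominators collected in front, which makes [vcoef]
    visible as its leading coefficient. *)
Definition lagr_poly (k : nat) : {poly F} :=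
  vcoef n alpha k *: \prod_(1 <= m < n.+1 | m != k) ('X - (alpha m)%:P).

Definition interp_poly (v : nat -> F) : {poly F} :=
  \sum_(1 <= k < n.+1) v k *: lagr_poly k.

Lemma vcoef_neq0 k : (1 <= k <= n)%N -> vcoef n alpha k != 0.
Proof.
move=> kn; rewrite /vcoef prodf_seq_neq0; apply/allP => m.
rewrite mem_index_iota => mn; apply/implyP => mk.
rewrite invr_eq0 subr_eq0; apply: contra mk => /eqP.
by move/alpha_inj => ->.
Qed.

Lemma lagr_polyE k x : (lagr_poly k).[x] = lagr alpha n k x.
Proof.
rewrite hornerZ horner_prod -big_split; apply: eq_bigr => m _ /=.
by rewrite !hornerE mulrC.
Qed.

Lemma interp_polyE (v : nat -> F) x :
  (interp_poly v).[x] = \sum_(1 <= k < n.+1) lagr alpha n k x * v k.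
Proof.
rewrite horner_sum; apply: eq_bigr => k _.
by rewrite hornerZ lagr_polyE mulrC.
Qed.

Let size_prod k : (1 <= k <= n)%N ->
  size (\prod_(1 <= m < n.+1 | m != k) ('X - (alpha m)%:P)) = n.
Proof.
move=> /andP[k1 kn]; rewrite -big_filter size_prod_XsubC -rem_filter ?iota_uniq //.
by rewrite size_rem ?mem_index_iota ?k1 // size_iota subn1 /= prednK // (leq_trans k1).
Qed.

Lemma coef_lagr_poly k : (1 <= k <= n)%N -> (lagr_poly k)`_n.-1 = vcoef n alpha k.
Proof.
move=> kn; rewrite coefZ; set w := \prod_(_ <= _ < _ | _) _.
have /monicP : w \is monic by apply: monic_prod_XsubC.
by rewrite lead_coefE (size_prod kn) => ->; rewrite mulr1.
Qed.

Lemma size_lagr_poly k : (1 <= k <= n)%N -> (size (lagr_poly k) <= n)%N.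
Proof. by move=> kn; rewrite (leq_trans (size_scale_leq _ _)) // (size_prod kn). Qed.

Lemma size_interp_poly v : (size (interp_poly v) <= n)%N.
Proof.
rewrite /interp_poly big_nat_cond; apply: (leq_trans (size_sum _ _ _)).
apply/bigmax_leqP_seq => k _ /andP[kn _].
exact: leq_trans (size_scale_leq _ _) (size_lagr_poly kn).
Qed.

Lemma lagr_alpha k i : (1 <= k <= n)%N -> (1 <= i <= n)%N ->
  lagr alpha n k (alpha i) = (k == i)%:R.
Proof.
move=> kn iN; have [<-|ki] := eqVneq.
  rewrite /lagr big_nat_cond big1 // => m /andP[mn mk]; rewrite divff //.
  by rewrite subr_eq0; apply: contra mk => /eqP/alpha_inj->.
rewrite /lagr -big_filter (bigD1_seq i) /=; first by rewrite subrr !mul0r.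
  by rewrite mem_filter eq_sym ki mem_index_iota.
by rewrite filter_uniq // iota_uniq.
Qed.

Lemma interp_alpha (V : lmodType F) (val : nat -> V) i : (1 <= i <= n)%N ->
  interp alpha n val (alpha i) = val i.
Proof.
move=> iN; rewrite /interp (bigD1_seq i) ?mem_index_iota ?iota_uniq //=.
rewrite lagr_alpha // eqxx scale1r big_nat_cond big1 ?addr0 // => k /andP[kn ki].
by rewrite lagr_alpha // (negPf ki) scale0r.
Qed.

Lemma interp_poly_alpha v i : (1 <= i <= n)%N -> (interp_poly v).[alpha i] = v i.
Proof. by move=> iN; rewrite interp_polyE; apply: (@interp_alpha F^o). Qed.

Lemma poly_eq0_alpha (w : {poly F}) (s : seq nat) : uniq s ->
  all (fun j => 1 <= j <= n)%N s -> (size w <= size s)%N ->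
  {in s, forall j, w.[alpha j] = 0} -> w = 0.
Proof.
move=> us /allP sn szw w0; apply: (@roots_geq_poly_eq0 _ _ (map alpha s)).
- by apply/allP => x /mapP[j js ->]; apply/rootP/w0.
- by rewrite map_inj_in_uniq // => j k /sn jn /sn kn; apply: alpha_inj.
- by rewrite size_map.
Qed.

(* The generalized Reed-Solomon code with multipliers [vcoef] is dual to the
   Reed-Solomon code: the sum is the coefficient of degree [n - 1] of [w]. *)
Lemma sum_vcoef_horner (w : {poly F}) : (size w < n)%N ->
  \sum_(1 <= j < n.+1) vcoef n alpha j * w.[alpha j] = 0.
Proof.
move=> szw.
have Ew : w = interp_poly (fun j => w.[alpha j]).
  apply/eqP; rewrite -subr_eq0; apply/eqP.
  apply: (@poly_eq0_alpha _ (index_iota 1 n.+1)); rewrite ?iota_uniq //.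
  - by apply/allP => j; rewrite mem_index_iota.
  - rewrite size_iota subn1 (leq_trans (size_polyD _ _)) // size_polyN.
    by rewrite geq_max (ltnW szw) size_interp_poly.
  - move=> j; rewrite mem_index_iota => jn.
    by rewrite hornerD hornerN interp_poly_alpha // subrr.
have : w`_n.-1 = 0 by rewrite nth_default // -ltnS prednK // (leq_ltn_trans _ szw).
rewrite {1}Ew coef_sum => w0; rewrite -[RHS]w0 big_nat_cond [RHS]big_nat_cond.
apply: eq_bigr => j /andP[jn _]; rewrite coefZ coef_lagr_poly //.
exact: mulrC.
Qed.

End Interpolation.

(** * Recovering one value of a polynomial from traces *)

(** Phrased with vanishing traces because responses are additive in [h]: it is applied to the
    difference of two candidate products. *)
Lemma trace_recovery (F : finFieldType) (E : {set F}) (alpha : nat -> F)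
    (n L N i : nat) (h : {poly F}) :
  {in [pred j | 1 <= j <= n]%N &, injective alpha} ->
  is_subfield E -> prime (ext_deg E [set: F]) -> alpha i \notin E ->
  (forall j, (L < j <= L + N)%N -> alpha j \in E) ->
  (1 <= i <= L)%N -> (L + N <= n)%N ->
  (size h + ext_deg E [set: F] <= N.+1)%N ->
  (forall j, (1 <= j <= N)%N ->
     ftrace E (vcoef n alpha (L + j) * kpoly n L N alpha i (alpha (L + j)%N)
               * h.[alpha (L + j)%N]) = 0) ->
  h.[alpha i] = 0.
Proof.
move=> a_inj sE dP aE aj iL LNn szh tr0; set d := ext_deg _ _ in dP szh.
pose kp : {poly F} :=
  \prod_(1 <= j < n.+1 | ~~ ((L < j <= L + N)%N || (j == i))) ('X - (alpha j)%:P).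
have kpE x : kp.[x] = kpoly n L N alpha i x.
  by rewrite horner_prod; apply: eq_bigr => j _; rewrite !hornerE.
(* The product omits at least [N + 1] of the [n] indices: the [N] servers and [i] itself. *)
have szkp : (size kp <= n - N)%N.
  rewrite /kp -big_filter size_prod_XsubC size_filter.
  pose Q : pred nat := fun j => (L < j <= L + N)%N || (j == i).
  rewrite -[count _ _]/(count (predC Q) (index_iota 1 n.+1)).
  have := count_predC Q (index_iota 1 n.+1); rewrite size_iota subn1 /=.
  suff : (N.+1 <= count Q (index_iota 1 n.+1))%N by lia.
  rewrite -size_filter -[N in (N.+1 <= _)%N](size_iota L.+1).
  apply: (@uniq_leq_size _ (i :: iota L.+1 N)).
    by rewrite /= iota_uniq mem_iota andbT; lia.
  move=> j; rewrite in_cons mem_iota mem_filter mem_index_iota /Q.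
  by case: eqP => [->|_] /=; lia.
have iN : (1 <= i <= n)%N by lia.
have kpi : kp.[alpha i] != 0.
  rewrite kpE /kpoly prodf_seq_neq0; apply/allP => j.
  rewrite mem_index_iota => jn; apply/implyP; rewrite negb_or => /andP[_ ji]; rewrite subr_eq0 eq_sym.
  by apply: contra ji => /eqP/a_inj ->.
have kp0 j : (1 <= j <= n)%N -> j != i -> ~~ (L < j <= L + N)%N -> kp.[alpha j] = 0.
  move=> jn ji jL; apply/rootP; rewrite /kp -big_filter -(big_map alpha predT
    (fun y => 'X - y%:P)) root_prod_XsubC; apply: map_f.
  by rewrite mem_filter (negPf jL) (negPf ji) mem_index_iota.
pose z := vcoef n alpha i * kp.[alpha i] * h.[alpha i].
suff /eqP : z = 0.
  by rewrite !mulf_eq0 (negPf kpi) (negPf (vcoef_neq0 a_inj iN)) => /eqP.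
apply: (ftrace_exp_eq0 sE dP aE) => m md.
(* The size bounds combine to [n - d + m], which is below [n] exactly because [m < d]. *)
have szw : (size (kp * h * 'X^m)%R < n)%N.
  have := size_polyMleq (kp * h) 'X^m; have := size_polyMleq kp h.
  by rewrite size_polyXn -/d in md *; lia.
have := congr1 (ftrace E) (sum_vcoef_horner a_inj szw).
rewrite ftrace0 // ftrace_sum // (bigD1_seq i) ?mem_index_iota ?iota_uniq //=.
rewrite big_nat_cond [X in _ + X]big1 ?addr0.
  move=> trE; rewrite -[RHS]trE !hornerM hornerXn; congr (ftrace E _); rewrite /z.
  by rewrite mulrC !mulrA.
move=> j /andP[jn ji]; rewrite !hornerM hornerXn.
(* Indices outside the servers are killed by [kp]; at a server, [alpha j ^+ m] lies in [E] and
   leaves the trace, whose remaining value is zero by assumption. *)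
have [jL|jL] := boolP (L < j <= L + N)%N; last first.
  by rewrite kp0 // !mul0r mulr0 ftrace0.
rewrite !mulrA mulrC ftraceZ //; last first.
  elim: m {md szw} => [|m IH]; first by rewrite expr0; case/is_subfieldP: sE.
  by rewrite exprS; case/is_subfieldP: sE => _ _ EBM _; apply: (EBM _ _ (aj _ jL) IH).2.
have -> : j = (L + (j - L))%N by lia.
by rewrite kpE tr0 ?mulr0 //; lia.
Qed.

(** * Matrix-valued interpolation, block products and mutual information *)

Lemma interp_mxE (F : fieldType) (alpha : nat -> F) (n a b : nat)
    (val : nat -> 'M[F]_(a, b)) (x : F) r s :
  interp alpha n val x r s = (interp_poly alpha n (fun k => val k r s)).[x].
Proof.
by rewrite interp_polyE /interp summxE; apply: eq_bigr => k _; rewrite mxE.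
Qed.

Lemma interp_mulmx_poly (F : fieldType) (alpha : nat -> F) (n a b c : nat)
    (u : nat -> 'M[F]_(a, b)) (v : nat -> 'M[F]_(b, c)) r t :
  exists2 h : {poly F}, (size h <= n.*2.-1)%N &
    forall x, (interp alpha n u x *m interp alpha n v x) r t = h.[x].
Proof.
exists (\sum_s interp_poly alpha n (fun k => u k r s)
             * interp_poly alpha n (fun k => v k s t)).
  apply: (leq_trans (size_sum _ _ _)); apply/bigmax_leqP => s _.
  apply: (leq_trans (size_polyMleq _ _)).
  have := size_interp_poly alpha n (fun k => u k r s).
  by have := size_interp_poly alpha n (fun k => v k s t); lia.
move=> x; rewrite mxE horner_sum; apply: eq_bigr => s _.
by rewrite hornerM !interp_mxE.
Qed.

(** Entrywise, the difference of the two interpolants has size at most [L + T] and vanishes at the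
    [L] data points and the [T] chosen server points, so it is zero, also at the mask points. *)
Lemma interp_inj (F : fieldType) (alpha : nat -> F) (n L T a b : nat)
    (u v : nat -> 'M[F]_(a, b)) (s : seq nat) :
  {in [pred i | 1 <= i <= n]%N &, injective alpha} ->
  (L + T <= n)%N -> uniq s -> size s = T ->
  all (fun j => 1 <= j <= n - L)%N s ->
  (forall k, (1 <= k <= L)%N -> u k = v k) ->
  {in s, forall j, interp alpha (L + T) u (alpha (L + j)%N) =
                   interp alpha (L + T) v (alpha (L + j)%N)} ->
  forall k, (1 <= k <= L + T)%N -> u k = v k.
Proof.
move=> a_inj LTn us sT /allP sn uv uvs k kLT; apply/matrixP => i j.
pose e w := interp_poly alpha (L + T) (fun k : nat => w k i j).
have a_inj' : {in [pred i | 1 <= i <= L + T]%N &, injective alpha}.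
  by move=> x y; rewrite !inE => xn yn; apply: a_inj; rewrite inE; lia.
suff /eqP : e u - e v = 0.
  rewrite subr_eq0 => /eqP/(congr1 (fun w => w.[alpha k])).
  by rewrite /e !interp_poly_alpha.
apply: (poly_eq0_alpha a_inj (s := iota 1 L ++ map (addn L) s)).
- rewrite cat_uniq iota_uniq map_inj_uniq ?us ?andbT /=; last exact: addnI.
  apply/hasPn => x /mapP[y /sn yn ->]; rewrite mem_iota; lia.
- rewrite all_cat; apply/andP; split; apply/allP => x.
    by rewrite mem_iota; lia.
  by case/mapP => y /sn yn ->; lia.
- rewrite size_cat size_iota size_map sT (leq_trans (size_polyD _ _)) //.
  by rewrite size_polyN geq_max !size_interp_poly.
move=> x; rewrite mem_cat => /orP[|/mapP[y ys ->]].
  rewrite mem_iota => xL; rewrite hornerD hornerN /e !interp_poly_alpha ?uv ?subrr //; lia.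
by rewrite hornerD hornerN -!interp_mxE uvs // subrr.
Qed.

Lemma sum_blocks (V : nmodType) (L k : nat) (f : nat -> V) :
  \sum_(0 <= t < L * k) f t = \sum_(1 <= i < L.+1) \sum_(s < k) f (i.-1 * k + s)%N.
Proof.
elim: L => [|L IH]; first by rewrite mul0n !big_nil.
rewrite big_nat_recr //= -IH mulSn addnC.
rewrite (big_cat_nat (n := (L * k)%N)) ?leq_addr //=; congr (_ + _).
rewrite -{1}[(L * k)%N]add0n big_addn addKn big_mkord.
by apply: eq_bigr => s _; rewrite addnC.
Qed.

Lemma mulmx_blocks (F : fieldType) (L a b c : nat) (A : 'M[F]_(a, b))
    (B : 'M[F]_(b, c)) : (L %| b)%N ->
  A *m B = \sum_(1 <= i < L.+1) Ablock (b %/ L) A i *m Bblock (b %/ L) B i.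
Proof.
move=> Lb; apply/matrixP => r t; rewrite summxE mxE.
(* The default 0 extends the summand to all naturals, so that the index range can be cut into
   blocks. *)
pose f s := if insub s is Some s' then A r s' * B s' t else 0.
transitivity (\sum_(0 <= s < b) f s).
  by rewrite big_mkord; apply: eq_bigr => s _; rewrite /f valK.
rewrite -{1}(divnK Lb) mulnC sum_blocks; apply: eq_bigr => i _.
rewrite mxE; apply: eq_bigr => s _; rewrite !mxE /f.
by case: insub => //=; rewrite mul0r.
Qed.

(** The second marginal is the constant [1 / #|Y|], so every logarithm is taken at 1. *)
Lemma mutual_info_indep (R : realType) (X Y : finType) (P : X -> R) :
  pmf P -> mutual_info (fun x (_ : Y) => P x / #|Y|%:R) = 0.
Proof.
move=> [P0 P1]; rewrite /mutual_info big1 // => x _; rewrite big1 // => y _.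
have Y0 : #|Y|%:R != 0 :> R.
  by rewrite pnatr_eq0 -lt0n; apply/card_gt0P; exists y.
case: ifPn => // Pxy.
have -> : \sum_(y' : Y) P x / #|Y|%:R = P x.
  by rewrite sumr_const -[LHS]mulr_natr mulfVK.
by rewrite -mulr_suml P1 mul1r divff ?ln1 ?mulr0.
Qed.

(** * Security and recoverability of the code *)

Section FtpCode.
Variables (F : finFieldType) (L T a b c : nat) (p : nat -> nat) (alpha : nat -> F).
Hypothesis L_gt0 : (0 < L)%N.
Hypothesis T_gt0 : (0 < T)%N.
Let n := npts L T p.
Hypothesis alpha_inj : {in [pred i | 1 <= i <= n]%N &, injective alpha}.

Let LT_le_n : (L + T <= n)%N.
Proof. by rewrite /n /npts /Nc; lia. Qed.

Lemma view_inj (s : seq nat) (A : 'M[F]_(a, b)) (B : 'M[F]_(b, c)) :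
  uniq s -> size s = T -> all (fun j => 1 <= j <= Nc L T p L)%N s ->
  injective (@view F L T a b c alpha s A B).
Proof.
move=> us sT sn RS RS' /ffunP eqv.
have s_idx j : j \in s -> exists t : 'I_T, j = nth 0%N s t.
  move=> js; have jT : (index j s < T)%N by rewrite -sT index_mem.
  by exists (Ordinal jT); rewrite /= nth_index.
have sn' : all (fun j => 1 <= j <= n - L)%N s by rewrite /n /npts addnK.
have kL (t : 'I_T) : (1 <= L + t.+1 <= L + T)%N by have := ltn_ord t; lia.
have kLF (t : 'I_T) : (L + t.+1 <= L)%N = false by lia.
case: RS RS' eqv => [R S] [R' S'] eqv; congr pair; apply/ffunP => t.
  have := interp_inj (u := fun k => if (k <= L)%N then Ablock (b %/ L) A k
                                    else maskR (R, S) (k - L))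
    (v := fun k => if (k <= L)%N then Ablock (b %/ L) A k else maskR (R', S') (k - L))
    alpha_inj LT_le_n us sT sn' _ _ (kL t).
  rewrite /= kLF addKn /maskR /= valK; apply=> [k /andP[_ ->] //|j /s_idx[t' ->]].
  by have := eqv t'; rewrite !ffunE => -[].
have := interp_inj (u := fun k => if (k <= L)%N then Bblock (b %/ L) B k
                                  else maskS (R, S) (k - L))
  (v := fun k => if (k <= L)%N then Bblock (b %/ L) B k else maskS (R', S') (k - L))
  alpha_inj LT_le_n us sT sn' _ _ (kL t).
rewrite /= kLF addKn /maskS /= valK; apply=> [k /andP[_ ->] //|j /s_idx[t' ->]].
by have := eqv t'; rewrite !ffunE => -[].
Qed.

Lemma ftp_T_secure (R : realType) : T_secure R L T a b c (Nc L T p L) alpha.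
Proof.
move=> pAB pAB_pmf s us sT sn.
pose Y : finType := {ffun 'I_T -> 'M[F]_(a, b %/ L) * 'M[F]_(b %/ L, c)}.
have cardY : #|masks_t F a (b %/ L) c T| = #|Y|.
  by rewrite card_prod !card_ffun card_prod expnMn.
rewrite -[RHS](@mutual_info_indep R _ Y _ pAB_pmf) /mutual_info.
have E x y : joint_AB_view (L:=L) (T:=T) alpha s pAB x y = pAB x / #|Y|%:R.
  rewrite /joint_AB_view cardsT cardY.
  (* For fixed data, masks and views are equinumerous, so the injective view map is a bijection and
     each view arises from exactly one choice of masks. *)
  have [g fg gf] := inj_card_bij (view_inj (A := x.1) (B := x.2) us sT sn) (eq_leq (esym cardY)).
  have -> : [set RS | view alpha s x.1 x.2 RS == y] = [set g y].
    by apply/setP => RS; rewrite !inE; apply/eqP/eqP => [<-|->]; rewrite ?fg ?gf.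
  by rewrite cards1 mul1r.
apply: eq_bigr => x _; apply: eq_bigr => y _; rewrite !E.
by rewrite (eq_bigr _ (fun y' _ => E x y')) (eq_bigr _ (fun x' _ => E x' y)).
Qed.

(** Decodability as injectivity: for each entry of each block product, the difference of the two
    polynomials has zero traces at the servers, hence vanishes at [alpha i]. *)
Lemma response_determines_mulmx (q0 : nat) (A A' : 'M[F]_(a, b)) (B B' : 'M[F]_(b, c))
    (RS RS' : masks_t F a (b %/ L) c T) :
  (L %| b)%N ->
  (forall i, (1 <= i <= L)%N -> prime (p i) /\ (p i <= p L)%N) ->
  (forall i, (1 <= i <= L)%N -> ext_deg (Fi q0 L alpha i) [set: F] = p i) ->
  (forall i, (1 <= i <= L)%N -> alpha i \notin Fi q0 L alpha i) ->
  (forall j, (L < j <= n)%N -> alpha j \in base_field F q0) ->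
  (forall i j, (1 <= i <= L)%N -> (1 <= j <= Nc L T p i)%N ->
     response q0 p alpha A B RS i j = response q0 p alpha A' B' RS' i j) ->
  A *m B = A' *m B'.
Proof.
move=> Lb pP deg aF aK eqr; rewrite !(mulmx_blocks _ _ Lb) !big_nat.
apply: eq_bigr => i iL; have [pi_prime pi_le] := pP i iL.
have iL' : (i <= L)%N by lia.
have iLT : (1 <= i <= L + T)%N by lia.
have a_inj' : {in [pred i | 1 <= i <= L + T]%N &, injective alpha}.
  by move=> x y; rewrite !inE => xn yn; apply: alpha_inj; rewrite inE; lia.
have fE (X : 'M[F]_(a, b)) (M : masks_t F a (b %/ L) c T) :
    Ablock (b %/ L) X i = ftp_f alpha X M (alpha i).
  by rewrite /ftp_f interp_alpha // iL'.
have gE (X : 'M[F]_(b, c)) (M : masks_t F a (b %/ L) c T) :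
    Bblock (b %/ L) X i = ftp_g alpha X M (alpha i).
  by rewrite /ftp_g interp_alpha // iL'.
rewrite (fE _ RS) (gE _ RS) (fE _ RS') (gE _ RS'); apply/matrixP => r t.
have hP (X : 'M[F]_(a, b)) (Y : 'M[F]_(b, c)) (M : masks_t F a (b %/ L) c T) :
    exists2 h : {poly F}, (size h <= (L + T).*2.-1)%N &
      forall x, (ftp_f alpha X M x *m ftp_g alpha Y M x) r t = h.[x].
  exact: interp_mulmx_poly.
have [h szh hE] := hP A B RS; have [h' szh' hE'] := hP A' B' RS'.
rewrite hE hE'; apply/eqP; rewrite -subr_eq0 -hornerN -hornerD; apply/eqP.
have sE : is_subfield (Fi q0 L alpha i) by exact: Fi_subfield.
apply: (trace_recovery (L := L) (N := Nc L T p i) alpha_inj sE).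
- by rewrite deg.
- exact: aF.
- move=> j jL; apply: (subsetP (base_field_sub_Fi _ _ _ _)); apply: aK.
  by move: jL; rewrite /n /npts /Nc; lia.
- exact: iL.
- by rewrite /n /npts /Nc; lia.
(* The product of two polynomials of size [L + T] has size at most [2 (L + T) - 1]; adding [p i]
   gives exactly [N_i + 1]. *)
- have : (size (h - h')%R <= (L + T).*2.-1)%N.
    by rewrite (leq_trans (size_polyD _ _)) // size_polyN geq_max szh.
  rewrite deg // /Nc; move: (size _) (prime_gt0 pi_prime) => w.
  lia.
move=> j jN.
have rE (X : 'M[F]_(a, b)) (Y : 'M[F]_(b, c)) (M : masks_t F a (b %/ L) c T) w :
    (forall x, (ftp_f alpha X M x *m ftp_g alpha Y M x) r t = w.[x]) ->
    ftrace (Fi q0 L alpha i) (vcoef n alpha (L + j) *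
      kpoly n L (Nc L T p i) alpha i (alpha (L + j)%N) * w.[alpha (L + j)%N])
    = response q0 p alpha X Y M i j r t.
  by move=> wE; rewrite /response iL jN mxE [in RHS]mxE -wE.
rewrite hornerD hornerN mulrBr ftraceB //.
by rewrite (rE _ _ _ _ hE) (rE _ _ _ _ hE') eqr // subrr.
Qed.

End FtpCode.

(** * The communication rate *)

Lemma total_rateE (L T a b c : nat) (p : nat -> nat) :
  (0 < L)%N -> (0 < a)%N -> (0 < c)%N -> (L %| b)%N ->
  (forall i, (1 <= i <= L)%N -> (0 < p i)%N) ->
  total_rate L T a b c p =
     (((Nc L T p L * b)%N)%:R / L%:R * (1 / a%:R + 1 / c%:R)
      + \sum_(1 <= i < L.+1) (Nc L T p i)%:R / (p i)%:R)^-1.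
Proof.
move=> L0 a0 c0 /dvdnP[k ->] p0; rewrite /total_rate.
have nz m : (0 < m)%N -> m%:R != 0 :> rat by rewrite pnatr_eq0 -lt0n.
have S0 : (0 < sym_Fq L p)%N.
  by rewrite /sym_Fq big_nat_cond; apply: prodn_cond_gt0 => j /andP[jL _]; apply: p0.
have num0 : (a * c * sym_Fq L p)%:R != 0 :> rat by rewrite nz // !muln_gt0 a0 c0.
rewrite -[LHS]invf_div; congr (_^-1); apply: (mulIf num0); rewrite mulfVK //.
rewrite natrD mulrDl; congr (_ + _).
  rewrite /upload_symbols mulnK // !(natrM, natrD).
  by field; rewrite !nz.
rewrite /download_symbols natr_sum big_distrl /= big_nat_cond [RHS]big_nat_cond.
apply: eq_bigr => i /andP[iL _].
(* A symbol of [Fi] costs a fraction [1 / p i] of a symbol of the full field, whence the terms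
   [N_i / p_i]. *)
have -> : sym_Fq L p = (p i * sym_Fi L p i)%N.
  by rewrite /sym_Fq (bigD1_seq i) ?mem_index_iota ?iota_uniq.
by rewrite !natrM; field; rewrite nz // p0.
Qed.

(** * The decoder and the assembly of the claims *)

Theorem theorem1 (R : realType) (L T : nat) (p : nat -> nat) (q0 : nat)
  (F : finFieldType) (a b c : nat) (alpha : nat -> F) :
  (0 < L)%N -> (0 < T)%N ->
  (forall i, (1 <= i <= L)%N -> prime (p i)) ->
  (forall i j, (1 <= i)%N -> (i < j)%N -> (j <= L)%N -> (p i < p j)%N) ->
  is_prime_power q0 -> (Nc L T p L <= q0)%N ->
  #|F| = (q0 ^ (\prod_(1 <= i < L.+1) p i))%N ->
  (0 < a)%N -> (0 < b)%N -> (0 < c)%N -> (L %| b)%N ->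
  (* [F_{q0}(alpha_i) : F_{q0}] = p_i for i in [L] *)
  (forall i, (1 <= i <= L)%N ->
     ext_deg (base_field F q0) (gen_field (base_field F q0) [set alpha i]) = p i) ->
  (* alpha_{L+1}, ..., alpha_n are distinct elements of F_{q0} *)
  (forall j, (L < j <= npts L T p)%N -> alpha j \in base_field F q0) ->
  (forall j k, (L < j <= npts L T p)%N -> (L < k <= npts L T p)%N ->
     alpha j = alpha k -> j = k) ->
  (* T-security *)
  T_secure R L T a b c (Nc L T p L) alpha
  (* the responses of the servers are matrices over F_i *)
  /\ (forall (A : 'M[F]_(a, b)) (B : 'M[F]_(b, c))
        (RS : masks_t F a (b %/ L) c T) (i j : nat) (r : 'I_a) (t : 'I_c),
        (1 <= i <= L)%N ->
        @response F L T q0 a b c p alpha A B RS i j r t \in Fi q0 L alpha i)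
  (* the user recovers AB from the responses *)
  /\ (exists dec : (nat -> nat -> 'M[F]_(a, c)) -> 'M[F]_(a, c),
        forall (A : 'M[F]_(a, b)) (B : 'M[F]_(b, c))
               (RS : masks_t F a (b %/ L) c T),
          dec (@response F L T q0 a b c p alpha A B RS) = A *m B)
  (* total communication rate *)
  /\ total_rate L T a b c p =
     (((Nc L T p L * b)%N)%:R / L%:R * (1 / a%:R + 1 / c%:R)
      + \sum_(1 <= i < L.+1) (Nc L T p i)%:R / (p i)%:R)^-1.
Proof.
move=> L0 T0 p_prime p_inc q0_pp _ cardF a0 b0 c0 Lb deg aK aK_inj.
have a_inj : {in [pred i | 1 <= i <= npts L T p]%N &, injective alpha}.
  by move=> i j iN jN; apply: (alpha_inj p_prime p_inc q0_pp cardF deg aK aK_inj).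
split; first exact: (ftp_T_secure L0 T0 a_inj).
split.
  move=> A B RS i j r t iL; rewrite /response; case: ifP => _.
    by rewrite mxE; apply/ftrace_mem/Fi_subfield.
  by rewrite mxE; case/is_subfieldP: (Fi_subfield L q0 alpha i).
split; last by apply: total_rateE => // i /p_prime/prime_gt0.
(* The decoder searches for any data and masks that explain the responses and outputs their product.
   Comparison on a finite index range keeps the test decidable. *)
pose same (r : nat -> nat -> 'M[F]_(a, c))
    (x : 'M[F]_(a, b) * 'M[F]_(b, c) * masks_t F a (b %/ L) c T) :=
  [forall i : 'I_L.+1, forall j : 'I_(npts L T p).+1,
     response q0 p alpha x.1.1 x.1.2 x.2 i j == r i j].
exists (fun r => if [pick x | same r x] is Some x then x.1.1 *m x.1.2 else 0).
move=> A B RS; case: pickP => [x /forallP rx|/(_ (A, B, RS))]; last first.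
  by move/negP; case; apply/forallP => i; apply/forallP => j.
have p_le i : (1 <= i <= L)%N -> (p i <= p L)%N.
  case/andP=> i1; rewrite leq_eqVlt => /predU1P[->//|iL].
  exact/ltnW/p_inc.
apply: (response_determines_mulmx L0 T0 a_inj Lb _ _ _ aK (RS := x.2) (RS' := RS)).
- by move=> i iL; split; [exact: p_prime|exact: p_le].
- by move=> i iL; apply: ext_deg_Fi deg _ _.
- by move=> i iL; apply: alpha_notin_Fi deg _ _.
move=> i j iL jN; have iL' : (i < L.+1)%N by lia.
(* Since [p i <= p L], all servers used for block [i] fall in the compared range. *)
have jN' : (j < (npts L T p).+1)%N.
  by have := p_le i iL; move: jN; rewrite /npts /Nc; lia.
by have /forallP/(_ (Ordinal jN'))/eqP := rx (Ordinal iL').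
Qed.
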